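(* Let $(\mathcal{H},\mathcal{M})$ be a simply matroid-rooted mixed hypergraph with $\mathcal{H}=(V\cup R,\mathcal{A}\cup\mathcal{E})$ and $\mathcal{M}=(R,r_{\mathcal{M}})$, and let $b(\mathcal{X})=r_{\mathcal{M}}(R)(|V_{\mathcal{X}}|-1)+r_{\mathcal{M}}(R_{\mathcal{X}})$ for $\mathcal{X}\subseteq\mathcal{A}\cup\mathcal{E}$. Then $$\mathcal{I}=\{\mathcal{X}\subseteq\mathcal{A}\cup\mathcal{E}: b(\mathcal{Y})\ge|\mathcal{Y}|\text{ for all nonempty }\mathcal{Y}\subseteq\mathcal{X}\}$$ is the family of independent sets of a matroid on $\mathcal{A}\cup\mathcal{E}$.
   Context: A mixed hypergraph $(W,\mathcal{A}\cup\mathcal{E})$ has a finite vertex set $W$, a finite set $\mathcal{A}$ of dyperedges (pairs $(tail(a),head(a))$ with $head(a)\in W$ and $\emptyset\ne tail(a)\subseteq W-head(a)$) and a finite set $\mathcal{E}$ of hyperedges (subsets of $W$ of size at least $2$). A dyperedge enters $X$ if its head is in $X$ and its tail meets $W-X$; it leaves $X$ if it enters $W-X$; a hyperedge enters $X$ if it meets $X$ and $W-X$. A vertex $r$ is a simple root if no dyperedge or hyperedge enters $\{r\}$, every dyperedge leaving $\{r\}$ has tail $\{r\}$, and at most one dyperedge leaves $\{r\}$. A simply matroid-rooted mixed hypergraph is $(\mathcal{H},\mathcal{M})$ with $\mathcal{H}=(V\cup R,\mathcal{A}\cup\mathcal{E})$, $V\cap R=\emptyset$, every vertex of $R$ a simple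 root, and $\mathcal{M}$ a matroid on $R$ with rank function $r_{\mathcal{M}}$. For $\mathcal{Z}\subseteq\mathcal{A}\cup\mathcal{E}$, $V_{\mathcal{Z}}$ is the set of vertices of $V$ incident to at least one element of $\mathcal{Z}$, and $R_{\mathcal{Z}}$ is the set of vertices of $R$ incident to at least one dyperedge of $\mathcal{Z}$. (This matroid is called the Tanigawa matroid $\mathcal{T}_{(\mathcal{H},\mathcal{M})}$.) *)

(* Defs.v *)
From mathcomp Require Import all_boot all_order all_algebra.

Set Implicit Arguments.
Unset Strict Implicit.
Unset Printing Implicit Defensive.

Import Order.TTheory GRing.Theory Num.Theory.

Section Matroid.
Variable T : finType.

(* A matroid on S is given by its family F of independent sets. *)
Definition is_matroid (S : {set T}) (F : {set {set T}}) : Prop :=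
  [/\ forall X, X \in F -> X \subset S,
      set0 \in F,
      forall X Y : {set T}, X \in F -> Y \subset X -> Y \in F
    & forall X Y : {set T}, X \in F -> Y \in F -> #|X| < #|Y| ->
        exists2 x, x \in Y :\: X & x |: X \in F].

Definition mrank (F : {set {set T}}) (X : {set T}) : nat :=
  \max_(Y in F | Y \subset X) #|Y|.

End Matroid.

Notation dyperedge W := ({set W} * W)%type.

(* The elements of the union of dyperedges and hyperedges; the two kinds are
   distinct objects, so that union is disjoint. *)
Notation edge W := (dyperedge W + {set W})%type.

Section MixedHypergraph.
Variable W : finType.

Definition tail (a : dyperedge W) : {set W} := a.1.
Definition head (a : dyperedge W) : W := a.2.

Record mixed_hypergraph := MixedHypergraph {
  dyperedges : {set dyperedge W};
  hyperedges : {set {set W}};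
  dyperedgesP : forall a, a \in dyperedges ->
    tail a != set0 /\ tail a \subset ~: [set head a];
  hyperedgesP : forall e, e \in hyperedges -> 1 < #|e|
}.

Definition edges (H : mixed_hypergraph) : {set edge W} :=
  [set inl a | a in dyperedges H] :|: [set inr e | e in hyperedges H].

Definition dyp_enters (a : dyperedge W) (X : {set W}) : bool :=
  (head a \in X) && (tail a :&: ~: X != set0).

Definition dyp_leaves (a : dyperedge W) (X : {set W}) : bool :=
  dyp_enters a (~: X).

Definition hyp_enters (e X : {set W}) : bool :=
  (e :&: X != set0) && (e :&: ~: X != set0).

Definition simple_root (H : mixed_hypergraph) (r : W) : Prop :=
  [/\ forall a, a \in dyperedges H -> ~~ dyp_enters a [set r],
      forall e, e \in hyperedges H -> ~~ hyp_enters e [set r],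
      forall a, a \in dyperedges H -> dyp_leaves a [set r] -> tail a = [set r]
    & #|[set a in dyperedges H | dyp_leaves a [set r]]| <= 1].

(* M is the family of independent sets of the matroid on R; the vertex set of
   the hypergraph is the whole type W. *)
Definition simply_matroid_rooted (H : mixed_hypergraph) (V R : {set W})
    (M : {set {set W}}) : Prop :=
  [/\ V :|: R = [set: W],
      V :&: R = set0,
      forall r, r \in R -> simple_root H r
    & is_matroid R M].

Definition dyp_incident (v : W) (a : dyperedge W) : bool :=
  (v \in tail a) || (v == head a).

Definition incident (v : W) (f : edge W) : bool :=
  match f with
  | inl a => dyp_incident v a
  | inr e => v \in e
  end.

Definition V_of (V : {set W}) (Z : {set edge W}) : {set W} :=
  [set v in V | [exists f in Z, incident v f]].

Definition R_of (R : {set W}) (Z : {set edge W}) : {set W} :=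
  [set r in R | [exists a : dyperedge W, (inl a \in Z) && dyp_incident r a]].

Definition tanigawa_b (V R : {set W}) (M : {set {set W}}) (X : {set edge W}) :
    int :=
  ((mrank M R)%:Z * (#|V_of V X|%:Z - 1) + (mrank M (R_of R X))%:Z)%R.

Definition tanigawa_indep (H : mixed_hypergraph) (V R : {set W})
    (M : {set {set W}}) : {set {set edge W}} :=
  [set X : {set edge W} | (X \subset edges H) &&
    [forall Y : {set edge W}, (Y \subset X) && (Y != set0) ==>
      (#|Y|%:Z <= tanigawa_b V R M Y)%R]].

End MixedHypergraph.

(* Main.v *)
(** The function b is monotone and submodular: both |V_X| and r(R_X) are a
    monotone submodular set function composed with a map that preserves unions.
    Edmonds' theorem then applies. Its augmentation axiom is proved by
    uncrossing: if X and Y are independent and no element of Y \ X can be added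
    to X, then each such element is spanned by a maximal tight subset D of X
    (one with f D = |D|). The maximal tight sets are disjoint, and a tight set D
    spans at most |D \ Y| elements of Y \ X, so |Y \ X| <= |X \ Y|. *)

Require Import Defs.
From mathcomp Require Import all_boot all_order all_algebra.
From mathcomp Require Import zify.

Import Order.TTheory GRing.Theory Num.Theory.

(** * Submodularity of the rank function of a matroid *)

Section MatroidRank.
Variables (T : finType) (S : {set T}) (F : {set {set T}}).
Hypothesis F_matroid : is_matroid S F.

Lemma indep_leq_mrank (X Y : {set T}) :
  Y \in F -> Y \subset X -> #|Y| <= mrank F X.
Proof. by move=> FY sYX; apply: leq_bigmax_cond; rewrite FY sYX. Qed.

Lemma mrankS (X Y : {set T}) : X \subset Y -> mrank F X <= mrank F Y.
Proof.
move=> sXY; apply/bigmax_leqP => Z /andP[FZ sZX].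
exact: indep_leq_mrank FZ (subset_trans sZX sXY).
Qed.

(** An inclusion-maximal independent set between [I] and [X] has maximum size, since augmentation
    from a larger one would enlarge it inside [X]. *)
Lemma mrank_extend (I X : {set T}) : I \in F -> I \subset X ->
  exists J : {set T}, [/\ J \in F, I \subset J, J \subset X & #|J| = mrank F X].
Proof.
case: F_matroid => _ F0 _ Faug FI sIX.
have PI : (I \in F) && (I \subset X) by rewrite FI.
have [J /maxsetP[/andP[FJ sJX] maxJ] sIJ] :=
  maxset_exists (P := fun J : {set T} => (J \in F) && (J \subset X)) PI.
exists J; split=> //; apply/eqP; rewrite eqn_leq indep_leq_mrank //=.
apply/bigmax_leqP => K /andP[FK sKX]; rewrite leqNgt; apply/negP => ltJK.
have [x /setDP[Kx NJx] FxJ] := Faug _ _ FJ FK ltJK.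
have xJX : x |: J \subset X by rewrite subUset sub1set (subsetP sKX).
have eqJ := maxJ (x |: J); rewrite FxJ xJX subsetUr in eqJ.
by move: NJx; rewrite -(eqJ isT isT) setU11.
Qed.

(** Extend a basis [I] of [X :&: Y] to a basis [J] of [X :|: Y]. The independent sets [J :&: X] and
    [J :&: Y] have union [J], and their intersection contains [I]. *)
Lemma mrank_submodular (X Y : {set T}) :
  mrank F (X :|: Y) + mrank F (X :&: Y) <= mrank F X + mrank F Y.
Proof.
have [_ F0 Fsub _] := F_matroid.
have [I [FI _ sI <-]] := mrank_extend set0 (X :&: Y) F0 (sub0set _).
have sIU : I \subset X :|: Y.
  by apply: subset_trans sI _; rewrite subIset // subsetUl.
have [J [FJ sIJ sJ <-]] := mrank_extend I (X :|: Y) FI sIU.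
have leX : #|J :&: X| <= mrank F X.
  by apply: indep_leq_mrank; [apply: Fsub FJ (subsetIl _ _) | apply: subsetIr].
have leY : #|J :&: Y| <= mrank F Y.
  by apply: indep_leq_mrank; [apply: Fsub FJ (subsetIl _ _) | apply: subsetIr].
apply: leq_trans (leq_add leX leY).
rewrite -(cardsUI (J :&: X)) -setIUr (setIidPl sJ) leq_add2l subset_leq_card //.
by rewrite -setIIr subsetI sIJ.
Qed.

End MatroidRank.

(** * Edmonds' theorem for intersecting submodular functions *)

Section Edmonds.
Variables (T : finType) (S : {set T}) (f : {set T} -> int).
(** Neither condition involves [f set0], which may be negative: [tanigawa_b] takes the value
    [- mrank M R] there. *)
Hypothesis f_mono : forall X Y : {set T},
  X != set0 -> X \subset Y -> (f X <= f Y)%R.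
Hypothesis f_submod : forall X Y : {set T}, X :&: Y != set0 ->
  (f (X :|: Y) + f (X :&: Y) <= f X + f Y)%R.

Definition edmonds_indep : {set {set T}} :=
  [set X : {set T} | (X \subset S) &&
    [forall Y : {set T}, (Y \subset X) && (Y != set0) ==> (#|Y|%:Z <= f Y)%R]].

Lemma edmonds_indepP (X : {set T}) :
  reflect (X \subset S /\ forall Y : {set T},
             Y \subset X -> Y != set0 -> (#|Y|%:Z <= f Y)%R)
          (X \in edmonds_indep).
Proof.
rewrite inE; apply: (iffP andP) => [[sX /forallP lef]|[sX lef]]; split=> //.
  by move=> Y sY nzY; have := lef Y; rewrite sY nzY.
by apply/forallP => Y; apply/implyP => /andP[]; apply: lef.
Qed.

(** Elements are absorbed one at a time: submodularity is applied to [x |: D] and [B :|: D], whose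
    intersection contains [D] and so has value at least [f D]. *)
Lemma f_setU_span (D A : {set T}) : D != set0 ->
  {in A, forall y, (f (y |: D) <= f D)%R} -> (f (A :|: D) <= f D)%R.
Proof.
move=> nzD; have [n] := ubnP #|A|; elim: n A => // n IH A ltAn spanA.
have [->|[x Ax]] := set_0Vmem A; first by rewrite set0U.
pose B := A :\ x.
have sDI : D \subset (x |: D) :&: (B :|: D) by rewrite subsetI !subsetUr.
have := f_submod _ _ (subset_neq0 sDI nzD).
rewrite setUACA setUid setD1K //.
have leI := f_mono _ _ nzD sDI.
have lex := spanA x Ax.
have leB : (f (B :|: D) <= f D)%R.
  apply: IH => [|y /setD1P[_ Ay]]; last exact: spanA.
  by move: ltAn; rewrite (cardsD1 x A) Ax.
lia.
Qed.

(** For independent [X] the reverse inequality holds as well, so this means equality. *)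
Definition tight (X D : {set T}) : bool :=
  [&& D != set0, D \subset X & (f D <= #|D|%:Z)%R].

(** Uncrossing: cardinality is modular, and independence bounds [f (D1 :&: D2)] below by the size of
    the intersection. *)
Lemma tight_setU (X D1 D2 : {set T}) : X \in edmonds_indep ->
  tight X D1 -> tight X D2 -> D1 :&: D2 != set0 -> tight X (D1 :|: D2).
Proof.
move=> /edmonds_indepP[_ lef] /and3P[nz1 s1 le1] /and3P[_ s2 le2] nzI.
apply/and3P; split; [by rewrite setU_eq0 negb_and nz1 | by rewrite subUset s1 |].
have := f_submod _ _ nzI.
have leI := lef _ (subset_trans (subsetIl D1 D2) s1) nzI.
have := cardsUI D1 D2; lia.
Qed.

Lemma trivIset_maximal_tight (X : {set T}) : X \in edmonds_indep ->
  trivIset [set D | maxset (tight X) D].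
Proof.
move=> FX; apply/trivIsetP => D1 D2; rewrite !inE.
move=> /maxsetP[t1 max1] /maxsetP[t2 max2]; apply: contraR.
rewrite -setI_eq0 => nzI; have tU := tight_setU X D1 D2 FX t1 t2 nzI.
by rewrite -{1}(max1 _ tU (subsetUl _ _)) (max2 _ tU (subsetUr _ _)).
Qed.

(** A set [C] violating independence of [y |: X] must contain [y], and [E := C :\ y] is tight. Any
    maximal tight [D] containing [E] works: [D :|: C = y |: D], while
    [f C <= f E <= f (D :&: C)]. *)
Lemma blocked_spanned (X : {set T}) (y : T) :
    X \in edmonds_indep -> [set y] \in edmonds_indep ->
    y |: X \notin edmonds_indep ->
  exists2 D : {set T}, maxset (tight X) D & (f (y |: D) <= f D)%R.
Proof.
move=> FX Fy NFyX.
have [sXS lefX] := edmonds_indepP _ FX; have [syS lefy] := edmonds_indepP _ Fy.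
have [C [sC nzC ltC]] : exists C : {set T},
    [/\ C \subset y |: X, C != set0 & (f C < #|C|%:Z)%R].
  move: NFyX; rewrite inE subUset syS sXS /= => /forallPn[C].
  by rewrite negb_imply -ltNge => /andP[/andP[sC nzC] ltC]; exists C.
have Cy : y \in C.
  apply/negPn/negP => NCy; move: ltC; rewrite ltNge lefX //.
  apply/subsetP => z Cz; have /setU1P[zy|//] := subsetP sC z Cz.
  by rewrite -zy Cz in NCy.
pose E := C :\ y.
have sEX : E \subset X by rewrite subDset.
have cardC : #|C| = #|E|.+1 by rewrite (cardsD1 y) Cy.
have nzE : E != set0.
  apply: contraTneq ltC => E0.
  have -> : C = [set y] by rewrite -(setD1K Cy) -/E E0 setU0.
  by rewrite -leNgt lefy // -card_gt0 cards1.
have leEC : (f E <= f C)%R by apply: f_mono nzE (subsetDl _ _).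
(* Integrality of [f] turns the strict bound by [#|E| + 1] into a bound by [#|E|]. *)
have leCE : (f C <= #|E|%:Z)%R by move: ltC; rewrite cardC; clear; lia.
have tE : tight X E by rewrite /tight nzE sEX (le_trans leEC leCE).
have leE := le_trans leCE (lefX E sEX nzE).
have [D maxD sED] := maxset_exists tE; exists D => //.
have sEI : E \subset D :&: C by rewrite subsetI sED subsetDl.
have nzI : D :&: C != set0 by apply: subset_neq0 sEI nzE.
have := f_submod _ _ nzI; have := f_mono _ _ nzE sEI.
have -> : D :|: C = y |: D.
  by rewrite -(setD1K Cy) -/E setUCA (setUidPl sED).
by move: leE; clear; lia.
Qed.

(** With [A] the set counted on the left, [A] and [D :&: Y] are disjoint subsets of [Y], so [#|A| +
    #|D :&: Y| <= f (A :|: (D :&: Y)) <= f (A :|: D) <= f D <= #|D|]. *)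
Lemma card_tight_span (X Y D : {set T}) : Y \in edmonds_indep -> tight X D ->
  #|[set y in Y :\: X | (f (y |: D) <= f D)%R]| <= #|D :\: Y|.
Proof.
move=> /edmonds_indepP[_ lefY] /and3P[nzD sDX leD].
set A := [set y in _ | _].
have sAY : A \subset Y.
  by apply/subsetP => y; rewrite !inE => /andP[/andP[]].
have A_D : A :&: (D :&: Y) = set0.
  apply/setP => y; rewrite !inE; case: (boolP (y \in D)) => [Dy|]; last first.
    by rewrite andbF.
  by rewrite (subsetP sDX y Dy).
have cardA : #|A :|: (D :&: Y)| = #|A| + #|D :&: Y|.
  by rewrite cardsU A_D cards0 subn0.
have cardD := cardsID Y D.
(* Independence bounds only nonempty subsets of [Y]; if this union is empty, so is [A]. *)
have [U0|nzU] := eqVneq (A :|: (D :&: Y)) set0.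
  by move: cardA; rewrite U0 cards0; lia.
have leU := lefY _ _ nzU; rewrite subUset sAY subsetIr in leU.
have leUD : (f (A :|: (D :&: Y)) <= f (A :|: D))%R.
  by apply: f_mono nzU (setUS _ (subsetIl _ _)).
have leAD : (f (A :|: D) <= f D)%R.
  by apply: f_setU_span nzD _ => y; rewrite inE => /andP[].
have := leU isT; lia.
Qed.

Theorem edmonds_matroid : is_matroid S edmonds_indep.
Proof.
have Fsub (X Y : {set T}) :
    X \in edmonds_indep -> Y \subset X -> Y \in edmonds_indep.
  move=> /edmonds_indepP[sX lef] sYX; apply/edmonds_indepP.
  split=> [|Z sZY]; first exact: subset_trans sYX sX.
  exact: lef (subset_trans sZY sYX).
split=> // [X /edmonds_indepP[] //||X Y FX FY ltXY].
  apply/edmonds_indepP; split=> [|Y]; first exact: sub0set.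
  by rewrite subset0 => ->.
have [/exists_inP[x] |/exists_inPn blocked] :=
  boolP [exists x in Y :\: X, x |: X \in edmonds_indep]; first by exists x.
pose P := [set D | maxset (tight X) D].
pose span D := [set y in Y :\: X | (f (y |: D) <= f D)%R].
have spanned : Y :\: X \subset \bigcup_(D in P) span D.
  apply/subsetP => y YXy; have /setDP[Yy _] := YXy.
  have Fy : [set y] \in edmonds_indep by apply: Fsub FY _; rewrite sub1set.
  have [D maxD leD] := blocked_spanned X y FX Fy (blocked y YXy).
  by apply/bigcupP; exists D; rewrite inE // YXy.
have leYX : #|Y :\: X| <= \sum_(D in P) #|D :\: Y|.
  apply: leq_trans (subset_leq_card spanned) _.
  elim/big_ind2: _ => [|A m B n leA leB|D]; first by rewrite cards0.
    by apply: leq_trans (leq_add leA leB); rewrite leq_card_setU.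
  by rewrite inE => /maxsetp; apply: card_tight_span.
(* Together with [leYX] this gives [#|Y| <= #|X|], a contradiction. *)
suff leXY : \sum_(D in P) #|D :\: Y| <= #|X :\: Y|.
  by have := cardsID X Y; have := cardsID Y X; rewrite (setIC X); lia.
(* In this form the sums over the disjoint members of [P] merge into one sum over their union. *)
have cardD (A : {set T}) : #|A :\: Y| = \sum_(x in A | x \notin Y) 1.
  by rewrite -sum1_card; apply: eq_bigl => x; rewrite inE andbC.
rewrite (eq_bigr _ (fun D _ => cardD D)).
have tP := trivIset_maximal_tight X FX.
rewrite -(big_trivIset_cond P (K := fun x => x \notin Y) (E := fun=> 1) tP) -cardD.
apply/subset_leq_card/setSD/bigcupsP => D.
by rewrite inE => /maxsetp /and3P[].
Qed.

End Edmonds.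

(** * Incidence maps preserve unions and inclusions *)

Section Incidence.
Variables (W : finType) (U : {set W}).

Lemma V_ofU (X Y : {set edge W}) : V_of U (X :|: Y) = V_of U X :|: V_of U Y.
Proof.
apply/setP => v; rewrite !inE -andb_orr; congr (_ && _).
apply/existsP/orP => [[g]|].
  by rewrite inE andb_orl => /orP[]; [left|right]; apply/existsP; exists g.
by case=> /existsP[g /andP[gX vg]]; exists g; rewrite inE gX vg ?orbT.
Qed.

Lemma R_ofU (X Y : {set edge W}) : R_of U (X :|: Y) = R_of U X :|: R_of U Y.
Proof.
apply/setP => v; rewrite !inE -andb_orr; congr (_ && _).
apply/existsP/orP => [[g]|].
  by rewrite inE andb_orl => /orP[]; [left|right]; apply/existsP; exists g.
by case=> /existsP[g /andP[gX vg]]; exists g; rewrite inE gX vg ?orbT.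
Qed.

Lemma V_ofS (X Y : {set edge W}) : X \subset Y -> V_of U X \subset V_of U Y.
Proof. by move=> /setUidPr <-; rewrite V_ofU subsetUl. Qed.

Lemma R_ofS (X Y : {set edge W}) : X \subset Y -> R_of U X \subset R_of U Y.
Proof. by move=> /setUidPr <-; rewrite R_ofU subsetUl. Qed.

End Incidence.

(** * Monotonicity and submodularity of [tanigawa_b] *)

Section TanigawaFunction.
Variables (W : finType) (V R : {set W}) (M : {set {set W}}).

Lemma tanigawa_b_mono (X Y : {set edge W}) :
  X \subset Y -> (tanigawa_b V R M X <= tanigawa_b V R M Y)%R.
Proof.
move=> sXY; have := subset_leq_card (V_ofS W V X Y sXY).
have := mrankS W M _ _ (R_ofS W R X Y sXY).
rewrite /tanigawa_b; nia.
Qed.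

(** A vertex may meet [X] and [Y] through different edges, so for [X :&: Y] the incidence maps give
    only inclusions; these suffice because cardinality and rank are monotone. *)
Lemma tanigawa_b_submodular (X Y : {set edge W}) : is_matroid R M ->
  (tanigawa_b V R M (X :|: Y) + tanigawa_b V R M (X :&: Y)
     <= tanigawa_b V R M X + tanigawa_b V R M Y)%R.
Proof.
move=> matM; rewrite /tanigawa_b V_ofU R_ofU.
have sub_card : #|V_of V (X :&: Y)| <= #|V_of V X :&: V_of V Y|.
  by rewrite subset_leq_card // subsetI !V_ofS ?subsetIl ?subsetIr.
have sub_rank : mrank M (R_of R (X :&: Y)) <= mrank M (R_of R X :&: R_of R Y).
  by rewrite mrankS // subsetI !R_ofS ?subsetIl ?subsetIr.
have := mrank_submodular W R M matM (R_of R X) (R_of R Y).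
have := cardsUI (V_of V X) (V_of V Y).
nia.
Qed.

End TanigawaFunction.

Theorem theorem14 (W : finType) (H : mixed_hypergraph W) (V R : {set W})
    (M : {set {set W}}) (hHM : simply_matroid_rooted H V R M) :
  is_matroid (edges H) (tanigawa_indep H V R M).
Proof.
have [_ _ _ matM] := hHM.
(* [tanigawa_indep] unfolds to [edmonds_indep] for this choice of [f]. *)
apply: (edmonds_matroid _ (edges H) (tanigawa_b V R M)) => X Y _.
  exact: tanigawa_b_mono.
exact: tanigawa_b_submodular.
Qed.
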